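(* Let $\mathbb{F}_q$ be the finite field of order $q$, where $q$ is a prime power, and let $\mathbb{F}_q[t]$ be the ring of polynomials in the indeterminate $t$ over $\mathbb{F}_q$. Then there is a subgroup of $\mathrm{SL}_3(\mathbb{F}_q[t])$ isomorphic to the free product $\mathbb{Z}^2 * \mathbb{Z}$. *)

(* Defs.v *)
From HB Require Import structures.
From mathcomp Require Import all_boot all_order all_algebra.

Set Implicit Arguments.
Unset Strict Implicit.
Unset Printing Implicit Defensive.

Import GRing.Theory.

Definition isomorphic (G H : groupType) : Prop :=
  exists f : {multiplicative G -> H}, bijective f.

Section SpecialLinear.
Local Open Scope ring_scope.
Variables (n : nat) (R : comNzRingType).

Record SL := MkSL { SLval :> 'M[R]_n; _ : \det SLval == 1 }.

HB.instance Definition _ := [isSub for SLval].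
HB.instance Definition _ := [Choice of SL by <:].

Implicit Types A B : SL.

Lemma det_SL A : \det A = 1.
Proof. exact/eqP/(valP A). Qed.

Fact SL_one_subproof : \det (1%:M : 'M[R]_n) == 1.
Proof. by rewrite det1. Qed.

Fact SL_mul_subproof A B : \det (A *m B) == 1.
Proof. by rewrite det_mulmx !det_SL mulr1. Qed.

Fact SL_inv_subproof A : \det (\adj A) == 1.
Proof.
by rewrite -[X in X == _]mul1r -(det_SL A) -det_mulmx mul_mx_adj det_SL det1.
Qed.

Definition SL_one := MkSL SL_one_subproof.
Definition SL_mul A B := MkSL (SL_mul_subproof A B).
(* As the determinant is 1, the adjugate is the inverse; unlike [invmx], it
   does not require R to be a comUnitRingType. *)
Definition SL_inv A := MkSL (SL_inv_subproof A).

Fact SL_mulA : associative SL_mul.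
Proof. by move=> A B C; apply/val_inj/mulmxA. Qed.
Fact SL_mul1 : left_id SL_one SL_mul.
Proof. by move=> A; apply/val_inj/mul1mx. Qed.
Fact SL_mulr1 : right_id SL_one SL_mul.
Proof. by move=> A; apply/val_inj/mulmx1. Qed.
Fact SL_mulV : left_inverse SL_one SL_inv SL_mul.
Proof. by move=> A; apply/val_inj; rewrite /= mul_adj_mx det_SL. Qed.
Fact SL_mulrV : right_inverse SL_one SL_inv SL_mul.
Proof. by move=> A; apply/val_inj; rewrite /= mul_mx_adj det_SL. Qed.

HB.instance Definition _ :=
  isGroup.Build SL SL_mulA SL_mul1 SL_mulr1 SL_mulV SL_mulrV.

End SpecialLinear.

Section FreeProduct.
Local Open Scope group_scope.
Variables G H : groupType.

Local Notation letter := (G + H)%type.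
Local Notation word := (seq letter).
Implicit Types (l : letter) (u v w : word).

Definition trivial_letter l : bool :=
  match l with inl a => a == 1 | inr b => b == 1 end.

Definition inv_letter l : letter :=
  match l with inl a => inl a^-1 | inr b => inr b^-1 end.

Definition alternate l l' : bool :=
  match l, l' with inl _, inr _ | inr _, inl _ => true | _, _ => false end.

Definition reduced w : bool :=
  all (predC trivial_letter) w && sorted alternate w.

(* Normal form of the word l :: w, for w already reduced. *)
Definition consr l w : word :=
  if trivial_letter l then w else
  match l, w with
  | inl a, inl a' :: w' => if a * a' == 1 then w' else inl (a * a') :: w'
  | inr b, inr b' :: w' => if b * b' == 1 then w' else inr (b * b') :: w'
  | _, _ => l :: w
  end.

Lemma reduced_behead l w : reduced (l :: w) -> reduced w.
Proof. by case/andP=> /= /andP[_ wN] /path_sorted ws; apply/andP; split. Qed.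

Lemma reduced_consr l w : reduced w -> reduced (consr l w).
Proof.
rewrite /consr; case: ifP => // lN1; case: w => [|l' w] wr.
  by move: lN1; case: l => a /= lN1; rewrite /reduced /= lN1.
have wr' := reduced_behead wr.
case: l l' lN1 wr => [a|b] [a'|b'] /= lN1 wr; do ?[case: ifP => // abN].
- by move: wr; rewrite /reduced /= abN => /andP[/andP[_ ->]]; case: w {wr'} => // -[].
- by move: wr; rewrite /reduced /= lN1.
- by move: wr; rewrite /reduced /= lN1.
- by move: wr; rewrite /reduced /= abN => /andP[/andP[_ ->]]; case: w {wr'} => // -[].
Qed.

Lemma reduced_consrE l w : reduced (l :: w) -> consr l w = l :: w.
Proof.
rewrite /reduced /consr; case: l => a /=; case: eqVneq => //= _;
  by case: w => [|[b|b] w] //=; rewrite andbF.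
Qed.

Lemma consr_mull a a' w : reduced w ->
  consr (inl a) (consr (inl a') w) = consr (inl (a * a')) w.
Proof.
pose put (c : G) v : word := if c == 1 then v else inl c :: v.
have consr_put b c v : alternate (inl 1) (head (inr 1) v) ->
  consr (inl b) (put c v) = put (b * c) v.
  move=> vN; rewrite /consr /put /=.
  case: (eqVneq b 1) => [->|bN]; first by rewrite mul1g.
  case: (eqVneq c 1) => [->|cN]; last by [].
  by rewrite mulg1 (negbTE bN); case: v vN => [|[d|d] v].
move=> wr; have [c [v [-> vN]]] : exists c v, w = put c v /\
    alternate (inl 1) (head (inr 1) v).
  case: w wr => [|[c|c] w] wr; first by exists 1, [::]; rewrite /put eqxx.
    exists c, w; move: wr; rewrite /reduced /put /= => /andP[/andP[/negbTE-> _]].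
    by case: w => [|[d|d] w].
  by exists 1, (inr c :: w); rewrite /put eqxx.
by rewrite !consr_put // mulgA.
Qed.

Lemma consr_mulr a a' w : reduced w ->
  consr (inr a) (consr (inr a') w) = consr (inr (a * a')) w.
Proof.
pose put (c : H) v : word := if c == 1 then v else inr c :: v.
have consr_put b c v : alternate (inr 1) (head (inl 1) v) ->
  consr (inr b) (put c v) = put (b * c) v.
  move=> vN; rewrite /consr /put /=.
  case: (eqVneq b 1) => [->|bN]; first by rewrite mul1g.
  case: (eqVneq c 1) => [->|cN]; last by [].
  by rewrite mulg1 (negbTE bN); case: v vN => [|[d|d] v].
move=> wr; have [c [v [-> vN]]] : exists c v, w = put c v /\
    alternate (inr 1) (head (inl 1) v).
  case: w wr => [|[c|c] w] wr; first by exists 1, [::]; rewrite /put eqxx.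
    by exists 1, (inl c :: w); rewrite /put eqxx.
  exists c, w; move: wr; rewrite /reduced /put /= => /andP[/andP[/negbTE-> _]].
  by case: w => [|[d|d] w].
by rewrite !consr_put // mulgA.
Qed.

Lemma consr_invl l w : reduced w -> consr (inv_letter l) (consr l w) = w.
Proof.
case: l => a wr; [rewrite [LHS]consr_mull // | rewrite [LHS]consr_mulr //];
  by rewrite mulVg /consr /= eqxx.
Qed.

Lemma reduced_foldr u v : reduced v -> reduced (foldr consr v u).
Proof. by move=> vr; elim: u => //= l u; apply: reduced_consr. Qed.

Lemma foldr_consr l u v : reduced v ->
  foldr consr v (consr l u) = consr l (foldr consr v u).
Proof.
move=> vr; have E1 m w : trivial_letter m -> consr m w = w by rewrite /consr => ->.
rewrite [consr l u]/consr; case: ifP => [l1|lN1]; first by rewrite E1.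
have ur := reduced_foldr _ vr.
case: l lN1 => a lN1; case: u => [|[b|b] u] //=.
  by rewrite consr_mull //; case: ifP => //= ab1; rewrite E1.
by rewrite consr_mulr //; case: ifP => //= ab1; rewrite E1.
Qed.

Definition inv_word w : word := rev (map inv_letter w).

Lemma reduced_inv w : reduced w -> reduced (inv_word w).
Proof.
case/andP=> wN ws; rewrite /reduced all_rev rev_sorted all_map sorted_map.
apply/andP; split.
  by apply: sub_all wN => -[a|a] /=; rewrite invg_eq1.
by apply: sub_sorted ws => -[a|a] [b|b].
Qed.

Lemma foldr_inv_word u v : reduced v ->
  foldr consr (foldr consr v u) (inv_word u) = v.
Proof.
move=> vr; elim: u => // l u IHu.
rewrite /inv_word map_cons rev_cons -cats1 foldr_cat [foldr _ _ [:: _]]/=.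
by rewrite consr_invl // reduced_foldr.
Qed.

Lemma inv_wordK : involutive inv_word.
Proof.
move=> w; rewrite /inv_word map_rev revK -map_comp map_id_in // => -[a|a] _ /=;
  by rewrite invgK.
Qed.

(* The free product G * H, realised by normal forms: words whose letters are
   nontrivial and come alternately from G and from H, multiplied by
   concatenation followed by reduction. It satisfies the universal property of
   the coproduct of groups, see [free_product_universal]. *)
Record free_product := FreeProduct { fpval :> word; _ : reduced fpval }.

HB.instance Definition _ := [isSub for fpval].
HB.instance Definition _ := [Choice of free_product by <:].

Implicit Types x y : free_product.

Lemma free_product_reduced x : reduced x.
Proof. exact: valP. Qed.

Definition fp_one := @FreeProduct [::] isT.
Definition fp_mul x y :=
  FreeProduct (reduced_foldr x (free_product_reduced y)).
Definition fp_inv x := FreeProduct (reduced_inv (free_product_reduced x)).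

Fact fp_mulA : associative fp_mul.
Proof.
move=> [u ur] [v vr] [w wr]; apply/val_inj => /=.
by elim: u {ur} => //= l u ->; rewrite foldr_consr.
Qed.
Fact fp_mul1 : left_id fp_one fp_mul.
Proof. by move=> x; apply/val_inj. Qed.
Fact fp_mulr1 : right_id fp_one fp_mul.
Proof.
move=> [u ur]; apply/val_inj => /=; elim: u ur => //= l u IHu ur.
by rewrite IHu ?reduced_consrE ?(reduced_behead ur).
Qed.
Fact fp_mulV : left_inverse fp_one fp_inv fp_mul.
Proof.
move=> [u ur]; apply/val_inj => /=.
have E : foldr consr [::] u = u by exact: (congr1 val (fp_mulr1 (FreeProduct ur))).
by rewrite -[RHS](foldr_inv_word u (isT : reduced [::])) E.
Qed.
Fact fp_mulrV : right_inverse fp_one fp_inv fp_mul.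
Proof.
move=> x; have {1}-> : x = fp_inv (fp_inv x) by apply/val_inj; rewrite /= inv_wordK.
exact: fp_mulV.
Qed.

HB.instance Definition _ :=
  isGroup.Build free_product fp_mulA fp_mul1 fp_mulr1 fp_mulV fp_mulrV.

Definition fp_inl (a : G) : free_product :=
  FreeProduct (reduced_consr (inl a) (isT : reduced [::])).
Definition fp_inr (b : H) : free_product :=
  FreeProduct (reduced_consr (inr b) (isT : reduced [::])).

Fact fp_inlM : {morph fp_inl : a a' / a * a'}.
Proof.
move=> a a'; apply/val_inj => /=.
by rewrite foldr_consr ?reduced_consr //= consr_mull.
Qed.
Fact fp_inrM : {morph fp_inr : b b' / b * b'}.
Proof.
move=> b b'; apply/val_inj => /=.
by rewrite foldr_consr ?reduced_consr //= consr_mulr.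
Qed.

HB.instance Definition _ := isMultiplicative.Build G free_product fp_inl fp_inlM.
HB.instance Definition _ := isMultiplicative.Build H free_product fp_inr fp_inrM.

Lemma free_product_universal (K : groupType)
    (f : {multiplicative G -> K}) (g : {multiplicative H -> K}) :
  exists h : {multiplicative free_product -> K},
    [/\ h \o fp_inl =1 f, h \o fp_inr =1 g
      & forall h' : {multiplicative free_product -> K},
          h' \o fp_inl =1 f -> h' \o fp_inr =1 g -> h' =1 h].
Proof.
pose e l : K := match l with inl a => f a | inr b => g b end.
have m1 (L : groupType) (p : {multiplicative L -> K}) : p 1 = 1.
  by apply: (mulgI (p 1)); rewrite -gmulfM !mulg1.
pose ev w : K := foldr (fun l k => e l * k) 1 w.
have evc l w : ev (consr l w) = e l * ev w.
  rewrite /consr; case: ifP => [l1|_].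
    by case: l l1 => a /= /eqP->; rewrite m1 mul1g.
  case: l w => a [|[b|b] w] //=; case: eqVneq => [ab1|_] /=;
    by rewrite mulgA -gmulfM // ab1 m1 mul1g.
have evM : {morph (fun x : free_product => ev x) : x y / x * y}.
  move=> [u ur] [v vr] /=; elim: u {ur} => [|l u IHu] /=; first by rewrite mul1g.
  by rewrite evc IHu mulgA.
pose h : {multiplicative free_product -> K} :=
  HB.pack (fun x : free_product => ev x) (isMultiplicative.Build _ _ _ evM).
exists h; split=> [a|b|h' h'f h'g [w wr]].
- by rewrite /= evc /= mulg1.
- by rewrite /= evc /= mulg1.
rewrite /=; elim: w wr => [|l w IHw] wr.
  by rewrite -[RHS](m1 _ h'); congr (h' _); apply/val_inj.
rewrite /= -(IHw (reduced_behead wr)).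
have <- : h' (FreeProduct (reduced_consr l (isT : reduced [::]))) = e l.
  by case: l {wr} => a /=; [exact: h'f | exact: h'g].
rewrite -gmulfM; congr (h' _); apply/val_inj => /=.
by rewrite foldr_consr ?(reduced_behead wr) //= reduced_consrE.
Qed.

End FreeProduct.

(* Main.v *)
(* The polynomial X^3 - t X^2 - (t + 3) X - 1 has the roots x, - 1 / (1 + x) and
   - (1 + x) / x, where t = (x^3 - 3 x - 1) / (x^2 + x); so F[t] embeds in F(x),
   on which we use the degree valuation. Multiplication by the units x and 1 + x
   of F[t, x], a free F[t]-module of rank 3, gives commuting matrices over F[t]
   that are diagonal in the eigencoordinates, and (2 p)-th powers of them
   generate a copy T of Z^2. Let s = 1 + w Tr be a transvection with Tr w = 0.
   If s_g = \sum_i g_i w_i is the trace of g w, then s^-1 g s = - s_g w Tr + (lower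
   terms), and s_g dominates all the entries of g for every g != 1 in T, provided
   that the w_i have degrees (d, d - 1, d): the two top terms of s_g can cancel
   only if two of the g_i have equal degree, in which case these differ by a p-th
   power of small degree. Hence T and s^-1 T s play ping-pong, and generate
   T * T, which contains Z^2 * Z. *)
Require Import Defs.
From HB Require Import structures.
From mathcomp Require Import all_boot all_order all_algebra all_field.
From mathcomp Require Import ring zify.
From Stdlib Require Import ClassicalEpsilon.

Set Implicit Arguments.
Unset Strict Implicit.
Unset Printing Implicit Defensive.

Import GRing.Theory Order.TTheory.

(** * The degree valuation at infinity on the rational function field *)

Section Degree.
Local Open Scope ring_scope.
Variable F : fieldType.
Local Notation K := {fraction {poly F}}.
Local Notation "p %:K" := (@tofrac {poly F} p)
  (at level 2, left associativity, format "p %:K").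
Implicit Types (p q : {poly F}) (y z : K) (n m l : int).

(* The degree valuation at infinity, as relations: the degree of [y] is at most
   [n], resp. equal to [n], resp. equal to [n] with leading coefficient 1. *)
Definition deg_le n y := exists p q,
  [/\ q != 0, y = p%:K / q%:K & (size p)%:Z <= (size q)%:Z + n].

Definition deg_eq n y := exists p q,
  [/\ p != 0, q != 0, y = p%:K / q%:K & (size p)%:Z = (size q)%:Z + n].

Definition monic_deg n y := exists p q,
  [/\ p \is monic, q \is monic, y = p%:K / q%:K
    & (size p)%:Z = (size q)%:Z + n].

(** The form without predecessor, with positivity of the sizes, suits the linear arithmetic of the
    degree estimates. *)
Lemma size_mulS p q : p != 0 -> q != 0 ->
  (0 < size p)%N /\ (0 < size q)%N /\
  (size (p * q)%R).+1 = (size p + size q)%N.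
Proof.
move=> p0 q0; have := size_mul p0 q0; rewrite -!size_poly_gt0 in p0 q0 *.
by move=> ->; do 2!split=> //; rewrite prednK // addn_gt0 p0.
Qed.

Lemma fracD p q p' q' : q != 0 -> q' != 0 ->
  p%:K / q%:K + p'%:K / q'%:K = (p * q' + p' * q)%:K / (q * q')%:K.
Proof.
by move=> q0 q'0; rewrite tofracD !tofracM addf_div // tofrac_eq0.
Qed.

Lemma fracM p q p' q' :
  (p%:K / q%:K) * (p'%:K / q'%:K) = (p * p')%:K / (q * q')%:K.
Proof. by rewrite !tofracM invfM mulrACA. Qed.

Lemma deg_eq_le n y : deg_eq n y -> deg_le n y.
Proof. by move=> [p [q [_ q0 -> e]]]; exists p, q; split=> //; rewrite e. Qed.

Lemma monic_deg_eq n y : monic_deg n y -> deg_eq n y.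
Proof.
by move=> [p [q [/monic_neq0 p0 /monic_neq0 q0 -> e]]]; exists p, q.
Qed.

Lemma deg_eq_neq0 n y : deg_eq n y -> y != 0.
Proof.
by move=> [p [q [p0 q0 -> _]]]; rewrite mulf_neq0 ?invr_eq0 ?tofrac_eq0.
Qed.

Lemma deg_leW n m y : n <= m -> deg_le n y -> deg_le m y.
Proof. by move=> nm [p [q [q0 -> e]]]; exists p, q; split=> //; lia. Qed.

Lemma deg_leD n y z : deg_le n y -> deg_le n z -> deg_le n (y + z).
Proof.
move=> [p [q [q0 -> e]]] [p' [q' [q'0 -> e']]]; rewrite fracD //.
exists (p * q' + p' * q), (q * q'); split=> //; first by rewrite mulf_neq0.
have : (size (p * q' + p' * q)%R
          <= maxn (size (p * q')%R) (size (p' * q)%R))%N.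
  exact: size_polyD.
have := size_mulS q0 q'0.
have := size_polyMleq p q'; have := size_polyMleq p' q; lia.
Qed.

Lemma deg_leN n y : deg_le n y -> deg_le n (- y).
Proof.
move=> [p [q [q0 -> e]]]; exists (- p), q.
by split=> //; rewrite ?size_polyN // tofracN mulNr.
Qed.

Lemma deg_leM n m y z : deg_le n y -> deg_le m z -> deg_le (n + m) (y * z).
Proof.
move=> [p [q [q0 -> e]]] [p' [q' [q'0 -> e']]]; rewrite fracM.
(* When both numerators vanish, the bound obtained from [q * q'] can fall short by one, so a large
   power of ['X] serves as denominator. *)
have [->|p0] := eqVneq p 0.
  exists 0, 'X^(absz (n + m)); split; first by rewrite monic_neq0 ?monicXn.
    by rewrite mul0r tofrac0 !mul0r.
  by rewrite size_poly0 size_polyXn; lia.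
exists (p * p'), (q * q'); split=> //; first by rewrite mulf_neq0.
have := size_polyMleq p p'; have := size_mulS p0 q0.
have := size_mulS q0 q'0; lia.
Qed.

Lemma deg_le0 n : deg_le n 0.
Proof.
exists 0, 'X^(absz n); split; first by rewrite monic_neq0 ?monicXn.
  by rewrite tofrac0 mul0r.
by rewrite size_poly0 size_polyXn; lia.
Qed.

Lemma deg_le_sum n (I : finType) (y : I -> K) :
  (forall i, deg_le n (y i)) -> deg_le n (\sum_i y i).
Proof.
by move=> yn; apply: big_rec => [|i z _]; [exact: deg_le0 | exact: deg_leD].
Qed.

Lemma deg_eqM n m y z : deg_eq n y -> deg_eq m z -> deg_eq (n + m) (y * z).
Proof.
move=> [p [q [p0 q0 -> e]]] [p' [q' [p'0 q'0 -> e']]]; rewrite fracM.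
exists (p * p'), (q * q'); rewrite !mulf_neq0 //; split=> //.
have := size_mulS p0 p'0; have := size_mulS q0 q'0; lia.
Qed.

Lemma deg_eqV n y : deg_eq n y -> deg_eq (- n) y^-1.
Proof.
move=> [p [q [p0 q0 -> e]]]; exists q, p; rewrite invf_div; split=> //; lia.
Qed.

Lemma deg_eqN n y : deg_eq n y -> deg_eq n (- y).
Proof.
move=> [p [q [p0 q0 -> e]]]; exists (- p), q.
by split; rewrite ?oppr_eq0 ?size_polyN // tofracN mulNr.
Qed.

Lemma deg_eqDl n m y z : m < n -> deg_eq n y -> deg_le m z -> deg_eq n (y + z).
Proof.
move=> mn [p [q [p0 q0 -> e]]] [p' [q' [q'0 -> e']]]; rewrite fracD //.
have s : (size (p' * q)%R < size (p * q')%R)%N.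
  have := size_mulS p0 q'0; have := size_mulS q0 q'0.
  have := size_polyMleq p' q; lia.
have S : size (p * q' + p' * q) = size (p * q') by rewrite size_polyDl.
exists (p * q' + p' * q), (q * q'); rewrite S -size_poly_gt0 S.
rewrite size_poly_gt0 !mulf_neq0 //; split=> //.
have := size_mulS p0 q'0; have := size_mulS q0 q'0; lia.
Qed.

Lemma deg_eq_le_leq n m y : deg_eq n y -> deg_le m y -> n <= m.
Proof.
move=> [p [q [p0 q0 -> e]]] [p' [q' [q'0 h e']]]; move/eqP: h.
rewrite eqr_div ?tofrac_eq0 // -!tofracM tofrac_eq => /eqP h.
have {h} : size (p * q') = size (p' * q) by rewrite h.
have := size_mulS p0 q'0; have := size_polyMleq p' q.
have := size_mulS q0 q'0; lia.
Qed.

Lemma deg_eq_inj n m y : deg_eq n y -> deg_eq m y -> n = m.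
Proof.
move=> yn ym; have := deg_eq_le_leq yn (deg_eq_le ym).
have := deg_eq_le_leq ym (deg_eq_le yn); lia.
Qed.

(** Pairwise distinct degrees leave no room for cancellation: the unique top term dominates. *)
Lemma deg_eq_sum3 n m l y z u : n != m -> m != l -> n != l ->
  deg_eq n y -> deg_eq m z -> deg_eq l u ->
  deg_eq (Num.max n (Num.max m l)) (y + z + u).
Proof.
have main n' m' l' y' z' u' : m' < n' -> l' < n' ->
    deg_eq n' y' -> deg_eq m' z' -> deg_eq l' u' -> deg_eq n' (y' + z' + u').
  move=> mn ln yn zm ul; apply: (deg_eqDl ln _ (deg_eq_le ul)).
  exact: (deg_eqDl mn yn (deg_eq_le zm)).
move=> nm ml nl yn zm ul.
have [[h1 h2]|[[h1 h2]|[h1 h2]]] :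
    (m < n) /\ (l < n) \/ (n < m) /\ (l < m) \/ (n < l) /\ (m < l) by lia.
- have -> : Num.max n (Num.max m l) = n by lia.
  exact: (main n m l).
- have -> : Num.max n (Num.max m l) = m by lia.
  by rewrite [y + z]addrC; apply: (main m n l).
have -> : Num.max n (Num.max m l) = l by lia.
by rewrite addrC addrA; apply: (main l n m).
Qed.

Lemma monic_deg1 : monic_deg 0 1.
Proof. by exists 1, 1; split; rewrite ?monic1 ?tofrac1 ?divr1 ?addr0. Qed.

Lemma deg_leX n y k : deg_le n y -> deg_le (n * k%:Z) (y ^+ k).
Proof.
move=> yn; elim: k => [|k IHk].
  by rewrite mulr0; apply: deg_eq_le; apply: monic_deg_eq; apply: monic_deg1.
have -> : n * k.+1%:Z = n + n * k by lia.
by rewrite exprS; apply: deg_leM.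
Qed.

Lemma deg_eqX n y k : deg_eq n y -> deg_eq (n * k%:Z) (y ^+ k).
Proof.
move=> yn; elim: k => [|k IHk].
  by rewrite mulr0; apply: monic_deg_eq; apply: monic_deg1.
have -> : n * k.+1%:Z = n + n * k by lia.
by rewrite exprS; apply: deg_eqM.
Qed.

Lemma monic_degM n m y z :
  monic_deg n y -> monic_deg m z -> monic_deg (n + m) (y * z).
Proof.
move=> [p [q [p1 q1 -> e]]] [p' [q' [p'1 q'1 -> e']]]; rewrite fracM.
exists (p * p'), (q * q'); rewrite !monicMl //; split=> //.
have [p0 q0] := (monic_neq0 p1, monic_neq0 q1).
have [p'0 q'0] := (monic_neq0 p'1, monic_neq0 q'1).
have := size_mulS p0 p'0; have := size_mulS q0 q'0; lia.
Qed.

Lemma monic_degV n y : monic_deg n y -> monic_deg (- n) y^-1.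
Proof.
move=> [p [q [p0 q0 -> e]]]; exists q, p; rewrite invf_div; split=> //; lia.
Qed.

Lemma monic_degX n y k : monic_deg n y -> monic_deg (n * k%:Z) (y ^+ k).
Proof.
move=> yn; elim: k => [|k IHk]; first by rewrite mulr0; exact: monic_deg1.
have -> : n * k.+1%:Z = n + n * k by lia.
by rewrite exprS; apply: monic_degM.
Qed.

Lemma monic_degXz n y (k : int) : monic_deg n y -> monic_deg (n * k) (y ^ k).
Proof.
move=> yn; case: k => k; first exact: monic_degX.
have -> : n * Negz k = - (n * k.+1%:Z) by lia.
by apply: monic_degV; apply: monic_degX.
Qed.

(** Over the common denominator both numerators are monic of the same size, so their top
    coefficients cancel. *)
Lemma monic_degB n y z :
  monic_deg n y -> monic_deg n z -> deg_le (n - 1) (y - z).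
Proof.
move=> [p [q [p1 q1 -> e]]] [p' [q' [p'1 q'1 -> e']]].
have [p0 q0] := (monic_neq0 p1, monic_neq0 q1).
have [p'0 q'0] := (monic_neq0 p'1, monic_neq0 q'1).
rewrite -mulNr -tofracN fracD // mulNr.
have pq1 : p * q' \is monic by rewrite monicMl.
have pq'1 : p' * q \is monic by rewrite monicMl.
exists (p * q' - p' * q), (q * q'); split=> //; first by rewrite mulf_neq0.
have S : size (p * q') = size (p' * q).
  have := size_mulS p0 q'0; have := size_mulS p'0 q0; lia.
suff : (size (p * q' - p' * q)%R < size (p * q')%R)%N.
  have := size_mulS p0 q'0; have := size_mulS q0 q'0; lia.
have s0 : (0 < size (p * q')%R)%N by rewrite size_poly_gt0 mulf_neq0.
rewrite -(prednK s0) ltnS; apply/leq_sizeP => j; rewrite leq_eqVlt => /orP[/eqP<-|].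
  rewrite coefB {2}S -!/(lead_coef _).
  by rewrite (monicP pq1) (monicP pq'1) subrr.
rewrite prednK // => h; rewrite coefB !nth_default ?subrr // -S //.
Qed.

End Degree.

(** * The two ping-pong sets and the degree estimates for them *)

Section PingPong.
Local Open Scope ring_scope.
Variable F : fieldType.
Local Notation K := {fraction {poly F}}.
Implicit Types (y g s w : 'I_3 -> K).

Definition i0 : 'I_3 := @Ordinal 3 0 isT.
Definition i1 : 'I_3 := @Ordinal 3 1 isT.
Definition i2 : 'I_3 := @Ordinal 3 2 isT.

Lemma sum_ord3 (V : nmodType) (f : 'I_3 -> V) :
  \sum_i f i = f i0 + f i1 + f i2.
Proof.
rewrite !big_ord_recl big_ord0 addr0 -addrA.
by congr (f _ + (f _ + f _)); apply: val_inj.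
Qed.

Lemma ord3_ind (P : 'I_3 -> Prop) : P i0 -> P i1 -> P i2 -> forall i, P i.
Proof.
move=> P0 P1 P2 [[|[|[|//]]] h].
- by rewrite (_ : Ordinal h = i0) //; apply: val_inj.
- by rewrite (_ : Ordinal h = i1) //; apply: val_inj.
- by rewrite (_ : Ordinal h = i2) //; apply: val_inj.
Qed.

(* A vector of [F(X)^3] is spread if its coordinate sum is not much smaller than
   its entries, close (to [w]) if it is nearly proportional to [w]. These are
   the two ping-pong sets, the integer [r] measuring the precision. *)
Definition spread (r : int) y := exists n,
  deg_eq n (\sum_i y i) /\ forall i, deg_le (n + r) (y i).

Definition close w (r : int) y := exists n c s,
  deg_eq n c /\ forall i, y i = c * (w i + s i) /\ deg_le r (s i).

(** The margin 5 is exactly what the estimates in [spread_of_close] and [close_of_spread]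
    require. *)
Definition expanding w g := exists n m,
  [/\ forall i, deg_le n (g i), deg_eq m (\sum_i g i * w i) & n + 5 <= m].

(* When [\sum_i w i = 0], [shear w] and [unshear w] are inverse transvections. *)
Definition shear w y : 'I_3 -> K := fun i => y i + (\sum_j y j) * w i.
Definition unshear w y : 'I_3 -> K := fun i => y i - (\sum_j y j) * w i.

(** The new coordinate sum is [c] times [\sum_i g i * w i], of degree [m], plus an error of degree
    at most [n + 4 < m]. *)
Lemma spread_of_close w g y : (forall i, deg_le 6 (w i)) ->
  expanding w g -> close w 4 y -> spread 1 (fun i => g i * y i).
Proof.
move=> w6 [n [m [gn gm nm]]] [k [c [s [ck ys]]]].
exists (k + m); split.
  have -> : \sum_i g i * y i = c * (\sum_i g i * w i + \sum_i g i * s i).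
    rewrite -big_split mulr_sumr; apply: eq_bigr => i _.
    by rewrite (ys i).1 mulrCA mulrDr.
  apply: deg_eqM => //; apply: (@deg_eqDl _ _ (n + 4)) => //; first by lia.
  by apply: deg_le_sum => i; apply: deg_leM => //; exact: (ys i).2.
move=> i; rewrite (ys i).1; apply: (@deg_leW _ (n + (k + 6))); first by lia.
apply: deg_leM => //; apply: deg_leM; first exact: deg_eq_le.
by apply: deg_leD => //; apply: deg_leW (ys i).2.
Qed.

Lemma close_of_spread w g y : (forall i, deg_le 6 (w i)) ->
  expanding w g -> spread 2 y ->
  close w 3 (unshear w (fun i => g i * shear w y i)).
Proof.
move=> w6 [n [m [gn gm nm]]] [k [yk y2]].
set l := \sum_i y i in yk *; set S := \sum_i g i * w i in gm *.
(* The leading part of the result is [c * w]; the remaining terms [g i * (y i + l * w i) - T * w i],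
   divided by [c], form the error. *)
pose c := - (l * S); pose T := \sum_i g i * y i.
have ck : deg_eq (k + m) c by apply: deg_eqN; apply: deg_eqM.
have c0 := deg_eq_neq0 ck.
exists (k + m), c, (fun i => c^-1 * (g i * (y i + l * w i) - T * w i)).
split=> // i; split.
  rewrite mulrDr mulVKf // /unshear.
  have -> : \sum_j g j * shear w y j = T + l * S.
    rewrite /T /S mulr_sumr -big_split; apply: eq_bigr => j _.
    by rewrite /shear mulrDr mulrCA.
  by rewrite mulrDl /c mulNr opprD addrCA -/l addrC -!addrA [RHS]addrCA addrC.
apply: (@deg_leW _ (- (k + m) + (n + k + 8))); first by lia.
apply: deg_leM; first by apply: deg_eq_le; apply: deg_eqV.
apply: deg_leD.
  apply: (@deg_leW _ (n + (k + 6))); first by lia.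
  apply: deg_leM => //; apply: deg_leD; first by apply: deg_leW (y2 i); lia.
  by apply: deg_leM => //; apply: deg_eq_le.
apply: deg_leN; apply: (@deg_leW _ ((n + (k + 2)) + 6)); first by lia.
by apply: deg_leM => //; apply: deg_le_sum => j; apply: deg_leM.
Qed.

(* If the two top terms of [\sum_i g i * w i] have the same degree, they may
   cancel; the p-th power makes [g i2 - g i0] drop by p degrees, and then
   [w i0 + w i2 = - w i1] takes over. *)
Lemma expanding_pchar w (p : nat) (a : 'I_3 -> int) (q : 'I_3 -> K) :
    prime p -> p \in [pchar K] ->
    deg_eq 6 (w i0) -> deg_eq 5 (w i1) -> deg_eq 6 (w i2) -> \sum_i w i = 0 ->
    (forall i, monic_deg (2 * a i) (q i)) ->
    \sum_i a i = 0 -> (a i0 != 0) || (a i1 != 0) ->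
  expanding w (fun i => q i ^+ p).
Proof.
move=> p_prime pK w0 w1 w2 sw qa sa an0.
have p2 := prime_gt1 p_prime.
pose b i := a i * p%:Z.
have qb i : monic_deg (2 * b i) (q i ^+ p).
  by rewrite /b mulrA; apply: monic_degX.
have ebi i n : deg_eq n (w i) -> deg_eq (2 * b i + n) (q i ^+ p * w i).
  by apply: deg_eqM; apply: monic_deg_eq.
have sb : b i0 + b i1 + b i2 = 0 by rewrite /b -!mulrDl -sum_ord3 sa mul0r.
have b0 i : (b i == 0) = (a i == 0) by rewrite /b mulf_eq0 eqz_nat; lia.
have bn0 : (b i0 != 0) || (b i1 != 0) by rewrite !b0.
pose N := Num.max (2 * b i0) (Num.max (2 * b i1) (2 * b i2)).
have gN i : deg_le N (q i ^+ p).
  apply: (@deg_leW _ (2 * b i)); last by apply: deg_eq_le; apply: monic_deg_eq.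
  by move: i; apply: ord3_ind; rewrite /N; lia.
exists N; rewrite sum_ord3.
(* The three terms have degrees [2 * b i0 + 6], [2 * b i1 + 5] and [2 * b i2 + 6]; by parity they
   are distinct unless [b i0 = b i2]. *)
have [b02|b02] := eqVneq (b i0) (b i2); last first.
  eexists; split; [exact: gN | apply: deg_eq_sum3 (ebi _ _ w0) (ebi _ _ w1) (ebi _ _ w2); lia | rewrite /N; lia].
have a02 : a i0 = a i2.
  by apply/(mulIf _ b02); rewrite eqz_nat; lia.
(* Now [b i1 = - 2 * b i0]: if [b i0] is negative, the middle term dominates. *)
have [b_neg|b_pos] : b i0 < 0 \/ 0 < b i0 by lia.
  exists (2 * b i1 + 5); split=> //; last by rewrite /N; lia.
  rewrite [q i0 ^+ p * w i0 + _]addrC -addrA; apply: (@deg_eqDl _ _ (2 * b i0 + 6)).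
  - lia.
  - exact: ebi.
  apply: deg_leD; apply: deg_eq_le; first exact: ebi.
  by rewrite b02; apply: ebi.
exists (2 * b i0 + 5); split=> //; last by rewrite /N; lia.
have -> : q i0 ^+ p * w i0 + q i1 ^+ p * w i1 + q i2 ^+ p * w i2 =
    - (q i0 ^+ p * w i1) + (q i1 ^+ p * w i1 + (q i2 - q i0) ^+ p * w i2).
  have -> : (q i2 - q i0) ^+ p = q i2 ^+ p - q i0 ^+ p.
    by rewrite -!(pFrobenius_autE pK) rmorphB.
  have -> : w i0 = - (w i1 + w i2).
    by apply/eqP; rewrite -addr_eq0 addrA -sum_ord3 sw.
  rewrite mulrN mulrDr opprD mulrDl mulNr -!addrA; congr (_ + _).
  by rewrite addrCA; congr (_ + _); rewrite addrC.
(* The term with the p-th power of [q i2 - q i0] has degree at most [2 * b i0 - p + 6], and [p] is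
   at least 2. *)
apply: (@deg_eqDl _ _ (2 * b i0 + 4)); first by lia.
  by apply: deg_eqN; apply: deg_eqM => //; apply: monic_deg_eq.
apply: deg_leD.
  by apply: (@deg_leW _ (2 * b i1 + 5)); [lia | apply: deg_eq_le; apply: ebi].
apply: (@deg_leW _ ((2 * a i0 - 1) * p%:Z + 6)); first by rewrite /b; lia.
apply: deg_leM; last exact: deg_eq_le.
apply: deg_leX; apply: monic_degB => //.
by rewrite a02.
Qed.

End PingPong.

(** * Integer powers, images of injective morphisms, and the ping-pong lemma *)

Section Groups.
Local Open Scope group_scope.

Definition expgz (G : groupType) (x : G) (k : int) : G :=
  match k with Posz n => x ^+ n | Negz n => x ^- n.+1 end.

Lemma expgz1D (G : groupType) (x : G) k :
  expgz x (1 + k)%R = x * expgz x k.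
Proof.
case: k => [k|[|k]]; first by rewrite /= expgS.
  by rewrite /= expg1 mulgV.
have -> : (1 + Negz k.+1)%R = Negz k by lia.
by rewrite /= [x ^+ k.+2]expgSr invgM mulVKg.
Qed.

Lemma expgzD (G : groupType) (x : G) k l :
  expgz x (k + l)%R = expgz x k * expgz x l.
Proof.
elim: k => [|k IHk|k IHk]; first by rewrite add0r mul1g.
  by rewrite -[Posz k.+1]/(1 + Posz k)%R -addrA !expgz1D IHk mulgA.
apply: (mulgI x); rewrite mulgA -!expgz1D.
have -> : (1 + - Posz k.+1 = - Posz k)%R by lia.
by rewrite -IHk; congr expgz; lia.
Qed.

Lemma commute_expgz (G : groupType) (x y : G) k l :
  commute x y -> commute (expgz x k) (expgz y l).
Proof.
have comX (u v : G) n : commute u v -> commute u (expgz v n).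
  move=> uv; case: n => n; first exact: commuteX.
  exact/commuteV/commuteX.
by move=> xy; apply: (comX); apply/commute_sym/comX/commute_sym.
Qed.

Lemma multiplicative1 (G L : groupType) (h : {multiplicative G -> L}) : h 1 = 1.
Proof. by apply: (mulgI (h 1)); rewrite -gmulfM !mulg1. Qed.

Lemma multiplicativeF (G L : groupType) (h : {multiplicative G -> L}) x y :
  h (x / y) = h x / h y.
Proof. by apply: (mulIg (h y)); rewrite -gmulfM !mulgVK. Qed.

(** Excluded middle makes membership in the image boolean; the isomorphism sends a point of the
    image to its preimage, picked by [xchoose]. *)
Lemma image_subgroup (G L : groupType) (h : {multiplicative G -> L}) :
  injective h -> exists (S : pred L) (K : subGroupType S), isomorphic K G.
Proof.
move=> h_inj.
pose S : pred L :=
  fun y => if excluded_middle_informative (exists x, h x = y) then true else false.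
have SP y : reflect (exists x, h x == y) (S y).
  rewrite /S; case: excluded_middle_informative => n; constructor.
    by case: n => x <-; exists x.
  by case=> x /eqP e; apply: n; exists x.
have S_group : group_closed S.
  split=> [|_ _ /SP[x /eqP<-] /SP[y /eqP<-]]; apply/SP.
    by exists 1; rewrite multiplicative1.
  by exists (x / y); rewrite multiplicativeF.
pose K : subGroupType S := HB.pack {y | S y} (SubChoice_isSubGroup.Build L S {y | S y} S_group).
exists S, K.
have preim (y : K) : exists x, h x == val y by apply/SP/(valP y).
pose f (y : K) : G := xchoose (preim y).
have fK y : h (f y) = val y by apply/eqP/(xchooseP (preim y)).
have fM : {morph f : y z / y * z}.
  by move=> y z; apply: h_inj; rewrite gmulfM !fK gmulfM.
pose f' : {multiplicative K -> G} := HB.pack f (isMultiplicative.Build K G f fM).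
exists f'.
have Sh x : S (h x) by apply/SP; exists x.
exists (fun x => Sub (h x) (Sh x)) => [y|x] /=.
  by apply: val_inj; rewrite SubK fK.
by apply: h_inj; rewrite fK SubK.
Qed.

Lemma free_product_cons (G H : groupType) (l : G + H) w
    (lwr : reduced (l :: w)) (wr : reduced w) :
  FreeProduct lwr =
    match l with inl a => fp_inl H a | inr b => fp_inr G b end * FreeProduct wr.
Proof.
apply: val_inj; rewrite /= -(reduced_consrE lwr).
by case: l lwr => a lwr; rewrite [RHS]foldr_consr.
Qed.

(** A nontrivial reduced word moves [c0] into [X] or [Y] according to its first letter, so it cannot
    act as the identity. The alternative [c = c0] covers the last letter, which acts first. *)
Lemma ping_pong (G H L : groupType) (T : Type) (act : L -> T -> T)
    (h : {multiplicative free_product G H -> L}) (X Y : T -> Prop) (c0 : T) :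
    (forall c, act 1 c = c) ->
    (forall x y c, act (x * y) c = act x (act y c)) ->
    (forall a c, a != 1 -> Y c \/ c = c0 -> X (act (h (fp_inl H a)) c)) ->
    (forall b c, b != 1 -> X c \/ c = c0 -> Y (act (h (fp_inr G b)) c)) ->
    ~ X c0 -> ~ Y c0 -> injective h.
Proof.
move=> act1 actM hX hY nX nY.
pose P (w : seq (G + H)) c : Prop := match w with
  | [::] => c = c0 | inl _ :: _ => X c | inr _ :: _ => Y c end.
have main w (wr : reduced w) : P w (act (h (FreeProduct wr)) c0).
  elim: w wr => [|l w IHw] wr.
    have -> : FreeProduct wr = 1 by apply: val_inj.
    by rewrite multiplicative1 act1.
  have wr' := reduced_behead wr; have {}IHw := IHw wr'.
  rewrite (free_product_cons wr wr') gmulfM actM.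
  have /andP[/= /andP[lN _] lw] := wr.
  move: (FreeProduct wr') IHw => v; case: l {wr} lN lw => a aN.
    by case: w {wr'} => [|[b|b] w] //= _ vw; apply: hX => //; [right | left].
  by case: w {wr'} => [|[b|b] w] //= _ vw; apply: hY => //; [right | left].
have h1 x : h x = 1 -> x = 1.
  case: x => w wr hw; apply: val_inj => /=.
  by have := main w wr; rewrite hw act1; case: w {hw} wr => [|[a|b] w].
move=> x y xy; apply: (mulIg y^-1).
by rewrite mulgV; apply: h1; rewrite multiplicativeF xy mulgV.
Qed.

End Groups.

(** * The roots of the cubic and their differences *)

Section CubicRoots.
Local Open Scope ring_scope.
Variables (E : fieldType) (x : E).
Hypotheses (x0 : x != 0) (x1 : 1 + x != 0).

(* The roots of X^3 - t X^2 - (t + 3) X - 1, permuted by x |-> - 1 / (1 + x). *)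
Definition cubic_root (i : 'I_3) : E :=
  nth 0 [:: x; - (1 + x)^-1; - ((1 + x) / x)] i.

Definition cubic_trace : E := \sum_i cubic_root i.

(* The difference of two consecutive roots, written as a polynomial in one of
   them so that it has coordinates in the base ring, see [gap0]. *)
Definition gap (i : 'I_3) : E :=
  let r := cubic_root i in - r ^+ 2 + (cubic_trace + 2) * r + 2.

Lemma cubic_rootE i : cubic_root i ^+ 3 =
  cubic_trace * cubic_root i ^+ 2 + (cubic_trace + 3) * cubic_root i + 1.
Proof.
rewrite /cubic_trace sum_ord3 /cubic_root /=.
by move: i; apply: ord3_ind => /=; field; rewrite x0 x1.
Qed.

(** The trace of the squared root, which is the last entry of the row in [shear_mx]. *)
Lemma sum_cubic_root2 :
  \sum_i cubic_root i ^+ 2 = cubic_trace ^+ 2 + 2 * cubic_trace + 6.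
Proof.
rewrite /cubic_trace !sum_ord3 /cubic_root /=.
by field; rewrite x0 x1.
Qed.

Lemma gap0 : gap i0 = cubic_root i0 - cubic_root i1.
Proof. by rewrite /gap /cubic_trace !sum_ord3 /cubic_root /=; field; rewrite x0 x1. Qed.

Lemma gap1 : gap i1 = cubic_root i1 - cubic_root i2.
Proof. by rewrite /gap /cubic_trace !sum_ord3 /cubic_root /=; field; rewrite x0 x1. Qed.

Lemma gap2 : gap i2 = cubic_root i2 - cubic_root i0.
Proof. by rewrite /gap /cubic_trace !sum_ord3 /cubic_root /=; field; rewrite x0 x1. Qed.

Lemma sum_gap : \sum_i gap i = 0.
Proof. by rewrite sum_ord3 gap0 gap1 gap2; ring. Qed.

Lemma cubic_root_neq0 i : cubic_root i != 0.
Proof.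
by move: i; apply: ord3_ind; rewrite /cubic_root /= ?oppr_eq0 ?mulf_neq0 ?invr_eq0.
Qed.

Lemma add1_cubic_root i :
  1 + cubic_root i = nth 0 [:: 1 + x; x / (1 + x); - x^-1] i.
Proof.
move: i; apply: ord3_ind; rewrite /cubic_root //=; field; first exact: x1.
exact: x0.
Qed.

Lemma add1_cubic_root_neq0 i : 1 + cubic_root i != 0.
Proof.
rewrite add1_cubic_root.
by move: i; apply: ord3_ind; rewrite /= ?oppr_eq0 ?mulf_neq0 ?invr_eq0.
Qed.

End CubicRoots.

(** * The explicit matrices over the base ring and their determinants *)

Section Matrices.
Local Open Scope ring_scope.
Variables (R : comNzRingType) (t : R).

Definition mx3 (s : seq (seq R)) : 'M[R]_3 := \matrix_(i, j) nth 0 (nth [::] s i) j.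

Lemma det_mx3 (M : 'M[R]_3) : \det M =
  M i0 i0 * (M i1 i1 * M i2 i2 - M i1 i2 * M i2 i1)
  - M i0 i1 * (M i1 i0 * M i2 i2 - M i1 i2 * M i2 i0)
  + M i0 i2 * (M i1 i0 * M i2 i1 - M i1 i1 * M i2 i0).
Proof.
(* With natural number indices, the lifted indices of the minors simplify by computation. *)
pose f (i j : nat) := M (inord i) (inord j).
have fE i j : M i j = f i j by rewrite /f !inord_val.
rewrite (expand_det_row _ i0) sum_ord3 /cofactor.
rewrite !(expand_det_row _ ord0) !big_ord_recl !big_ord0 /cofactor.
rewrite !det_mx11 !mxE !fE /= /bump /= !addn0 !add0n.
by ring.
Qed.

(** Multiplication by a root r in the basis 1, r, r^2, acting on columns. *)
Definition companion : 'M[R]_3 :=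
  mx3 [:: [:: 0; 0; 1]; [:: 1; 0; t + 3]; [:: 0; 1; t]].

(* The identity plus a column times a row: the row is the trace form on the basis
   1, r, r^2 of [F[t][r]], the column holds the coordinates of [t^5 * gap]. *)
Definition shear_mx : 'M[R]_3 :=
  \matrix_(i, j) ((i == j)%:R + t ^+ 5 * nth 0 [:: 2; t + 2; - 1] i
                                * nth 0 [:: 3; t; t ^+ 2 + 2 * t + 6] j).

Lemma det_companion : \det companion = 1.
Proof. by rewrite det_mx3 !mxE /=; ring. Qed.

Lemma det_companion1 : \det (1 + companion) = -1.
Proof. by rewrite det_mx3 !mxE /=; ring. Qed.

(** The row of the transvection annihilates its column, because [gap] has trace 0. *)
Lemma det_shear : \det shear_mx = 1.
Proof. by rewrite det_mx3 !mxE /=; ring. Qed.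

End Matrices.

(** * The action in eigencoordinates *)

Section Action.
Local Open Scope ring_scope.
Variables (R : comNzRingType) (E : fieldType) (f : {rmorphism R -> E}).
Variables (t : R) (x : E).
Hypotheses (x0 : x != 0) (x1 : 1 + x != 0) (ft : f t = cubic_trace x).
Implicit Types (c : 'cV[E]_3) (W : SL 3 R) (z : 'I_3 -> E).

Local Notation r := (cubic_root x).

Definition act W c : 'cV[E]_3 := map_mx f W *m c.

Lemma act1 c : act 1%g c = c.
Proof. by rewrite /act /= map_mx1 mul1mx. Qed.

Lemma actM W W' c : act (W * W')%g c = act W (act W' c).
Proof. by rewrite /act /= map_mxM mulmxA. Qed.

(* The left eigenvectors (1, r, r^2) of the companion matrix as functionals. *)
Definition coord c (i : 'I_3) : E := \sum_(j < 3) r i ^+ j * c j 0.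

Lemma coordD c d i : coord (c + d) i = coord c i + coord d i.
Proof.
by rewrite -big_split; apply: eq_bigr => j _; rewrite mxE mulrDr.
Qed.

Lemma coord_companion c i :
  coord (map_mx f (companion t) *m c) i = r i * coord c i.
Proof.
apply/eqP; rewrite -subr_eq0 /coord !sum_ord3 !mxE !sum_ord3 !mxE /=.
rewrite !(rmorph0, rmorph1, rmorphD, rmorph_nat) ft.
have e := cubic_rootE x0 x1 i.
(* What remains is the cubic equation of [r i], multiplied by the last entry of [c]. *)
rewrite [X in X == 0](_ : _ = (cubic_trace x * r i ^+ 2
  + (cubic_trace x + 3) * r i + 1 - r i ^+ 3) * c i2 0); last by ring.
by rewrite e subrr mul0r.
Qed.

Definition scales W z := forall c i, coord (act W c) i = z i * coord c i.

Lemma scalesM W W' z z' :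
  scales W z -> scales W' z' -> scales (W * W')%g (fun i => z i * z' i).
Proof. by move=> Wz W'z c i; rewrite actM Wz W'z mulrA. Qed.

Lemma scalesX W z n : scales W z -> scales (W ^+ n)%g (fun i => z i ^+ n).
Proof.
move=> Wz c i; elim: n => [|n IHn]; first by rewrite expg0 act1 mul1r.
by rewrite expgS actM Wz IHn exprS mulrA.
Qed.

Lemma scalesV W z : (forall i, z i != 0) ->
  scales W z -> scales W^-1%g (fun i => (z i)^-1).
Proof.
move=> z0 Wz c i; apply: (mulfI (z0 i)).
by rewrite -Wz -actM mulgV act1 mulVKf.
Qed.

Lemma scalesXz W z k : (forall i, z i != 0) ->
  scales W z -> scales (expgz W k) (fun i => z i ^ k).
Proof.
move=> z0 Wz; case: k => n; first exact: scalesX.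
by apply: scalesV => [i|]; [rewrite expf_neq0 | apply: scalesX].
Qed.

Definition companionSL : SL 3 R := MkSL (introT eqP (det_companion t)).

(* The unit 1 + r has norm -1, hence the square. *)
Fact det_companion1_sqr :
  \det ((1%:M + companion t) *m (1%:M + companion t)) == 1.
Proof. by rewrite det_mulmx det_companion1 mulrNN mulr1. Qed.

Definition companion1_sqrSL : SL 3 R := MkSL det_companion1_sqr.

Definition shearSL : SL 3 R := MkSL (introT eqP (det_shear t)).

Lemma scales_companionSL : scales companionSL r.
Proof. by move=> c i; apply: coord_companion. Qed.

Lemma scales_companion1_sqrSL :
  scales companion1_sqrSL (fun i => (1 + r i) ^+ 2).
Proof.
have h c i : coord (map_mx f (1%:M + companion t) *m c) i = (1 + r i) * coord c i.
  by rewrite map_mxD map_mx1 mulmxDl mul1mx coordD coord_companion mulrDl mul1r.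
by move=> c i; rewrite /act /= map_mxM -mulmxA !h mulrA.
Qed.

Lemma commute_companion : commute companionSL companion1_sqrSL.
Proof.
have h : companion t *m (1%:M + companion t) = (1%:M + companion t) *m companion t.
  by rewrite mulmxDl mulmxDr mul1mx mulmx1.
by apply: val_inj; rewrite /= mulmxA h -mulmxA h mulmxA.
Qed.

(** The eigencoordinates of the column of [shear_mx]. The fifth power raises the degrees 1, 0, 1 of
    the gaps to 6, 5, 6, which provides the margin in [expanding]. *)
Definition shear_dir (i : 'I_3) : E := cubic_trace x ^+ 5 * gap x i.

Lemma sum_shear_dir : \sum_i shear_dir i = 0.
Proof. by rewrite -mulr_sumr sum_gap // mulr0. Qed.

Lemma sum_coord c : \sum_i coord c i = 3 * c i0 0 + cubic_trace x * c i1 0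
  + (cubic_trace x ^+ 2 + 2 * cubic_trace x + 6) * c i2 0.
Proof.
rewrite -sum_cubic_root2 // /cubic_trace /coord !sum_ord3 /=; ring.
Qed.

Lemma coord_shearSL c : coord (act shearSL c) =1
  fun i => coord c i + (\sum_j coord c j) * shear_dir i.
Proof.
move=> i; rewrite sum_coord /shear_dir /gap {1 2}/coord !sum_ord3 /act.
rewrite !mxE !sum_ord3 !mxE /=.
rewrite !(rmorphD, rmorphM, rmorphXn, rmorphN, rmorph0, rmorph1, rmorph_nat) /= ft; ring.
Qed.

Lemma coord_shearSLV c : coord (act shearSL^-1%g c) =1
  fun i => coord c i - (\sum_j coord c j) * shear_dir i.
Proof.
move=> i; set d := act _ c.
have e j : coord c j = coord d j + (\sum_k coord d k) * shear_dir j.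
  by rewrite -coord_shearSL /d -actM mulgV act1.
(* The shear preserves the coordinate sum, so its inverse only changes a sign. *)
have -> : \sum_j coord c j = \sum_j coord d j.
  rewrite (eq_bigr _ (fun j _ => e j)) big_split /= -mulr_sumr.
  by rewrite sum_shear_dir mulr0 addr0.
by rewrite e addrK.
Qed.

(** A point just outside both ping-pong sets: it is spread to precision 2 but not 1, and close to
    precision 4 but not 3. *)
Definition base_point : 'cV[E]_3 :=
  \col_i nth 0 [:: cubic_trace x ^+ 5 * 2;
    cubic_trace x ^+ 5 * (cubic_trace x + 2) + cubic_trace x ^+ 3;
    - cubic_trace x ^+ 5] i.

Lemma coord_base_point i :
  coord base_point i = shear_dir i + cubic_trace x ^+ 3 * r i.
Proof. rewrite /coord /shear_dir /gap !sum_ord3 !mxE /=; ring. Qed.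

End Action.

(** * Degrees of the roots, of the shear direction and of the base point *)

Section RootDegrees.
Local Open Scope ring_scope.
Variable F : fieldType.
Local Notation K := {fraction {poly F}}.
Local Notation x := (tofrac 'X : K).
Local Notation r := (cubic_root x).
Local Notation T := (cubic_trace x).
Local Notation w := (shear_dir x).

Lemma tofracX_neq0 : x != 0.
Proof. by rewrite tofrac_eq0 polyX_eq0. Qed.

Lemma tofracX1E : 1 + x = tofrac ('X - (- 1)%:P).
Proof. by rewrite tofracB polyCN tofracN opprK addrC polyC1 tofrac1. Qed.

Lemma tofracX1_neq0 : 1 + x != 0.
Proof. by rewrite tofracX1E tofrac_eq0 polyXsubC_eq0. Qed.

Lemma monic_deg_tofracX : monic_deg 1 x.
Proof.
exists 'X, 1; split; rewrite ?monicX ?monic1 ?tofrac1 ?divr1 //.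
by rewrite size_polyX size_poly1.
Qed.

Lemma monic_deg_tofracX1 : monic_deg 1 (1 + x).
Proof.
exists ('X - (- 1)%:P), 1; split; rewrite ?monicXsubC ?monic1 //.
  by rewrite tofracX1E tofrac1 divr1.
by rewrite size_XsubC size_poly1.
Qed.

Definition root_deg (i : 'I_3) : int := nth 0 [:: 1; -1; 0] i.
Definition root1_deg (i : 'I_3) : int := nth 0 [:: 1; 0; -1] i.

(** Squaring removes the signs of the roots, as [monic_deg] demands leading coefficient 1. *)
Lemma monic_deg_root_sqr i : monic_deg (2 * root_deg i) (r i ^+ 2).
Proof.
have [X X1] := (monic_deg_tofracX, monic_deg_tofracX1).
move: i; apply: ord3_ind; rewrite /cubic_root /root_deg /= ?sqrrN.
- exact: (monic_degX 2 X).
- exact: (monic_degX 2 (monic_degV X1)).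
- exact: (monic_degX 2 (monic_degM X1 (monic_degV X))).
Qed.

Lemma monic_deg_root1_sqr i : monic_deg (2 * root1_deg i) ((1 + r i) ^+ 2).
Proof.
have [X X1] := (monic_deg_tofracX, monic_deg_tofracX1).
rewrite (add1_cubic_root tofracX_neq0 tofracX1_neq0).
move: i; apply: ord3_ind; rewrite /root1_deg /= ?sqrrN.
- exact: (monic_degX 2 X1).
- exact: (monic_degX 2 (monic_degM X (monic_degV X1))).
- exact: (monic_degX 2 (monic_degV X)).
Qed.

Lemma deg_eq_root i : deg_eq (root_deg i) (r i).
Proof.
have [X X1] := (monic_deg_eq monic_deg_tofracX, monic_deg_eq monic_deg_tofracX1).
move: i; apply: ord3_ind; rewrite /cubic_root /root_deg //=.
- exact: deg_eqN (deg_eqV X1).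
- exact: deg_eqN (deg_eqM X1 (deg_eqV X)).
Qed.

Lemma deg_eq_trace : deg_eq 1 T.
Proof.
rewrite /cubic_trace sum_ord3 -addrA.
apply: (@deg_eqDl _ _ 0) => //; first exact: (deg_eq_root i0).
by apply: deg_leD; [apply: (@deg_leW _ (-1)) => // |];
  apply: deg_eq_le; [exact: (deg_eq_root i1) | exact: (deg_eq_root i2)].
Qed.

Lemma deg_eq_shear_dir (i : 'I_3) : deg_eq (nth 0 [:: 6; 5; 6] i) (w i).
Proof.
have [h0 h1] := (tofracX_neq0, tofracX1_neq0).
have T5 := deg_eqX 5 deg_eq_trace.
have [[r0 r1] r2] := (deg_eq_root i0, deg_eq_root i1, deg_eq_root i2).
move: i; apply: ord3_ind; rewrite /shear_dir /=.
- rewrite (gap0 h0 h1); apply: (@deg_eqM _ 5 1) => //.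
  apply: (@deg_eqDl _ _ (-1)) => //; exact/deg_leN/deg_eq_le.
- rewrite (gap1 h0 h1); apply: (@deg_eqM _ 5 0) => //; rewrite addrC.
  apply: (@deg_eqDl _ _ (-1)) => //; [exact: deg_eqN | exact: deg_eq_le].
- rewrite (gap2 h0 h1); apply: (@deg_eqM _ 5 1) => //; rewrite addrC.
  apply: (@deg_eqDl _ _ 0) => //; [exact: deg_eqN | exact: deg_eq_le].
Qed.

Lemma deg_le_shear_dir i : deg_le 6 (w i).
Proof.
have h := deg_eq_le (deg_eq_shear_dir i); apply: deg_leW h.
by move: i; apply: ord3_ind.
Qed.

Lemma expanding_torus (p : nat) (m n : int) :
    prime p -> p \in [pchar K] -> (m != 0) || (n != 0) ->
  expanding w (fun i => ((r i ^+ 2) ^ m * ((1 + r i) ^+ 2) ^ n) ^+ p).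
Proof.
move=> p_prime pK mn.
have [h0 h1] := (tofracX_neq0, tofracX1_neq0).
(* These degrees are [m + n], [- m], [- n]: their sum is 0, and the first two vanish only if
   [m = n = 0]. *)
apply: (expanding_pchar (a := fun i => root_deg i * m + root1_deg i * n)) => //.
- exact: (deg_eq_shear_dir i0).
- exact: (deg_eq_shear_dir i1).
- exact: (deg_eq_shear_dir i2).
- exact: (sum_shear_dir h0 h1).
- move=> i; rewrite mulrDr !mulrA.
  apply: monic_degM; apply: monic_degXz;
    [exact: monic_deg_root_sqr | exact: monic_deg_root1_sqr].
- by rewrite sum_ord3 /root_deg /root1_deg /=; lia.
- by rewrite /root_deg /root1_deg /=; lia.
Qed.

Section BasePoint.
Variable y : 'I_3 -> K.
Hypothesis yE : forall i, y i = w i + T ^+ 3 * r i.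

Let T3r i : deg_eq (3 + root_deg i) (T ^+ 3 * r i).
Proof. exact: deg_eqM (deg_eqX 3 deg_eq_trace) (deg_eq_root i). Qed.

Let sumy : \sum_i y i = T ^+ 4.
Proof.
rewrite (eq_bigr _ (fun i _ => yE i)) big_split /=.
rewrite (sum_shear_dir tofracX_neq0 tofracX1_neq0) add0r -mulr_sumr.
by rewrite -exprSr.
Qed.

Let sumy_deg : deg_eq 4 (\sum_i y i).
Proof. by rewrite sumy; exact: (deg_eqX 4 deg_eq_trace). Qed.

Let T3r4 i : deg_le 4 (T ^+ 3 * r i).
Proof.
apply: deg_leW (deg_eq_le (T3r i)).
by move: i; apply: ord3_ind.
Qed.

Lemma base_point_spread : spread 2 y.
Proof.
exists 4; split=> [//|i]; rewrite yE.
apply: deg_leD; first exact: deg_le_shear_dir.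
by apply: deg_leW (T3r4 i).
Qed.

Lemma base_point_close : close w 4 y.
Proof.
exists 0, 1, (fun i => T ^+ 3 * r i); split=> [|i].
  exact/monic_deg_eq/monic_deg1.
by rewrite mul1r yE; split.
Qed.

Let y0_deg : deg_eq 6 (y i0).
Proof. by rewrite yE; apply: deg_eqDl (deg_eq_shear_dir i0) (T3r4 i0). Qed.

Lemma base_point_not_spread : ~ spread 1 y.
Proof.
case=> n [yn y1].
by have := deg_eq_le_leq y0_deg (y1 i0); rewrite (deg_eq_inj yn sumy_deg).
Qed.

Lemma base_point_not_close : ~ close w 3 y.
Proof.
case=> n [c [s [cn ys]]].
(* As [w] sums to zero, only the error contributes to the coordinate sum, of degree 4; this forces
   [n >= 1], while the entry [y i0] of degree 6 forces [n = 0]. *)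
have n1 : 4 <= n + 3.
  apply: deg_eq_le_leq sumy_deg _.
  rewrite (eq_bigr _ (fun i _ => (ys i).1)) -mulr_sumr big_split /=.
  rewrite (sum_shear_dir tofracX_neq0 tofracX1_neq0) add0r.
  apply: deg_leM; first exact: deg_eq_le.
  by apply: deg_le_sum => i; exact: (ys i).2.
have : deg_eq (n + 6) (y i0).
  rewrite (ys i0).1; apply: deg_eqM => //.
  exact: deg_eqDl (deg_eq_shear_dir i0) (ys i0).2.
by move=> /(deg_eq_inj y0_deg); lia.
Qed.

End BasePoint.
End RootDegrees.

Lemma exprX_exprzAC (E : unitRingType) (y : E) (n : nat) (k : int) :
  ((y ^+ n) ^ k = (y ^ k) ^+ n)%R.
Proof. by rewrite !exprnP exprzAC. Qed.

(** * The free product inside the special linear group *)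

Section Representation.
Local Open Scope ring_scope.
Variables (F : fieldType) (p : nat).
Hypotheses (p_prime : prime p) (pF : p \in [pchar F]).
Local Notation K := {fraction {poly F}}.
Local Notation x := (tofrac 'X : K).
Local Notation T := (cubic_trace x).
Local Notation w := (shear_dir x).
Local Notation x0 := (tofracX_neq0 F).
Local Notation x1 := (tofracX1_neq0 F).

Let pK : p \in [pchar K].
Proof. exact: (rmorph_pchar (@tofrac {poly F} \o polyC)). Qed.

Definition param : {rmorphism {poly F} -> K} :=
  horner_eval T \o map_poly (@tofrac {poly F} \o polyC).

Lemma paramX : param 'X = T.
Proof. by rewrite /param /= map_polyX /horner_eval hornerX. Qed.

(** The eigenvalues of [A] and [B] are p-th powers of squares, as [expanding_torus] requires;
    [companion1_sqrSL] is already a square, hence the smaller exponent of [B]. *)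
Local Notation A := (companionSL ('X : {poly F}) ^+ (2 * p))%g.
Local Notation B := (companion1_sqrSL ('X : {poly F}) ^+ p)%g.
Local Notation S := (shearSL ('X : {poly F})).
Local Notation r := (cubic_root x).

Definition torus (u : Algebra.to_multiplicative (int * int)%type) :
  SL 3 {poly F} := (expgz A u.1 * expgz B u.2)%g.

Fact torusM : {morph torus : u v / (u * v)%g}.
Proof.
move=> u v; rewrite /torus !expgzD -!mulgA; congr (_ * _)%g; rewrite !mulgA.
congr (_ * _)%g; apply: commute_expgz; apply: commuteX2.
exact: commute_companion.
Qed.

HB.instance Definition _ := isMultiplicative.Build _ _ torus torusM.

(** One cyclic subgroup of the conjugated torus suffices for the factor Z. *)
Definition sheared_cycle (k : Algebra.to_multiplicative int) :
  SL 3 {poly F} := (S^-1 * expgz A k * S)%g.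

Fact sheared_cycleM : {morph sheared_cycle : k l / (k * l)%g}.
Proof.
move=> k l; rewrite /sheared_cycle expgzD -!mulgA; congr (_ * (_ * _))%g.
by rewrite mulVKg.
Qed.

HB.instance Definition _ := isMultiplicative.Build _ _ sheared_cycle sheared_cycleM.

Lemma scales_expgz_A k : scales param x (expgz A k) (fun i => ((r i ^+ 2) ^ k) ^+ p).
Proof.
move=> c i.
have r0 j : r j ^+ (2 * p) != 0 by exact/expf_neq0/(cubic_root_neq0 x0 x1 j).
have sA := scalesX (2 * p) (scales_companionSL x0 x1 paramX).
rewrite (scalesXz k r0 sA c i).
by rewrite exprM exprX_exprzAC.
Qed.

Lemma scales_expgz_B k :
  scales param x (expgz B k) (fun i => (((1 + r i) ^+ 2) ^ k) ^+ p).
Proof.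
move=> c i; have r0 j : ((1 + r j) ^+ 2) ^+ p != 0.
  exact/expf_neq0/expf_neq0/(add1_cubic_root_neq0 x0 x1 j).
have sB := scalesX p (scales_companion1_sqrSL x0 x1 paramX).
rewrite (scalesXz k r0 sB c i).
by rewrite exprX_exprzAC.
Qed.

Lemma scales_torus u : scales param x (torus u)
  (fun i => ((r i ^+ 2) ^ u.1 * ((1 + r i) ^+ 2) ^ u.2) ^+ p).
Proof.
move=> c i; rewrite exprMn.
exact: scalesM (scales_expgz_A u.1) (scales_expgz_B u.2) c i.
Qed.

Lemma spread_ext n (y z : 'I_3 -> K) : y =1 z -> spread n y -> spread n z.
Proof.
move=> yz [m [ym yn]]; exists m; split=> [|i]; last by rewrite -yz.
by rewrite -(eq_bigr _ (fun i _ => yz i)).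
Qed.

Lemma close_ext n (y z : 'I_3 -> K) : y =1 z -> close w n y -> close w n z.
Proof.
by move=> yz [m [c [s [cm h]]]]; exists m, c, s; split=> // i; rewrite -yz.
Qed.

Lemma spread_torus u c : u != 1%g ->
  close w 4 (coord x c) -> spread 1 (coord x (act param (torus u) c)).
Proof.
move=> u1 yc; apply: spread_ext (fun i => esym (scales_torus u c i)) _.
apply: spread_of_close yc; first exact: deg_le_shear_dir.
apply: expanding_torus => //; rewrite -negb_and; apply: contra u1.
by case: u => m n /= /andP[/eqP-> /eqP->].
Qed.

Lemma close_sheared_cycle k c : k != 1%g ->
  spread 2 (coord x c) -> close w 3 (coord x (act param (sheared_cycle k) c)).
Proof.
move=> k1 yc; pose g i := ((r i ^+ 2) ^ k * ((1 + r i) ^+ 2) ^ (0 : int)) ^+ p.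
apply: (@close_ext _ (unshear w (fun i => g i * shear w (coord x c) i))).
  move=> i; rewrite /sheared_cycle !actM.
  rewrite (coord_shearSLV x0 x1 paramX) /unshear.
  have e j : coord x (act param (expgz A k) (act param S c)) j =
      g j * shear w (coord x c) j.
    by rewrite scales_expgz_A (coord_shearSL x0 x1 paramX) /g expr0z mulr1.
  by rewrite e (eq_bigr _ (fun j _ => e j)).
apply: close_of_spread yc; first exact: deg_le_shear_dir.
by apply: expanding_torus => //; rewrite orbF.
Qed.

Lemma free_product_embeds : exists h : {multiplicative
    free_product (Algebra.to_multiplicative (int * int)%type)
                 (Algebra.to_multiplicative int) -> SL 3 {poly F}}, injective h.
Proof.
have [h [hl hr _]] := free_product_universal torus sheared_cycle.
exists h; have yE := coord_base_point x.
apply: (@ping_pong _ _ _ _ (act param) h (fun c => spread 1 (coord x c))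
  (fun c => close w 3 (coord x c)) (base_point x)).
- exact: act1.
- exact: actM.
- move=> u c u1 yc; rewrite [h _]hl; apply: spread_torus => //.
  (* Precision 3 implies precision 4, and the base point also has precision 4; the slack of one lets
     it enter the game from outside both sets. *)
  case: yc => [[m [d [s [dm h']]]]|->]; last exact: base_point_close.
  exists m, d, s; split=> // i; split; first exact: (h' i).1.
  by apply: deg_leW (h' i).2.
- move=> k c k1 yc; rewrite [h _]hr; apply: close_sheared_cycle => //.
  case: yc => [[m [ym y1]]|->]; last exact: base_point_spread.
  by exists m; split=> // i; apply: deg_leW (y1 i); lia.
- exact: (base_point_not_spread yE).
- exact: (base_point_not_close yE).
Qed.

End Representation.

Theorem corollary3 (p k : nat) (F : finFieldType)
    (p_prime : prime p) (k_gt0 : (0 < k)%N) (cardF : #|F| = (p ^ k)%N) :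
  exists (S : pred (SL 3 {poly F})) (K : subGroupType S),
    isomorphic K
      (free_product (Algebra.to_multiplicative (int * int)%type) (Algebra.to_multiplicative int)).
Proof.
have [h h_inj] := free_product_embeds p_prime (card_finPcharP cardF p_prime).
exact: image_subgroup h_inj.
Qed.
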